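(* Let $k$ be an infinite field, let $S=\langle g_1,\dots,g_n\rangle$ be a numerical semigroup with smallest minimal generator $g_1$, and let $R=k[[t^S]]$. If $|D_h|\le h+1$ for every integer $h\ge 2$, then the Hilbert function $H_R$ is non-decreasing.
   Context: A numerical semigroup $S$ is a subsemigroup of $(\mathbb{N},+)$ containing $0$; $S=\langle g_1,\dots,g_n\rangle$ means that $g_1<g_2<\dots<g_n$ is its minimal set of generators, and it is assumed that $\gcd(g_1,\dots,g_n)=1$ (equivalently $\mathbb{N}\setminus S$ is finite). Put $M=S\setminus\{0\}$, $0M=S$, and for $h\ge 1$ let $hM=\{m_1+\dots+m_h : m_1,\dots,m_h\in M\}$. For $h\ge 2$ define $$D_h=\{s\in (h-1)M\setminus hM : s+g_1\in (h+1)M\}.$$ The semigroup ring is $R=k[[t^S]]=k[[t^{g_1},\dots,t^{g_n}]]$, a one-dimensional local domain with maximal ideal $\mathfrak{m}=(t^{g_1},\dots,t^{g_n})$. Its Hilbert function is $H_R(h)=\dim_k \mathfrak{m}^h/\mathfrak{m}^{h+1}$ for $h\ge 0$ (with $\mathfrak{m}^0=R$), and one has $H_R(h)=|hM\setminus (h+1)M|$ for all $h\ge 0$. Non-decreasing means $H_R(h-1)\le H_R(h)$ for all $h\ge 1$. *)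

(* Defs.v *)
From HB Require Import structures.
From mathcomp Require Import all_boot all_order all_algebra.
From mathcomp Require Import boolp classical_sets functions cardinality.

Set Implicit Arguments.
Unset Strict Implicit.
Unset Printing Implicit Defensive.

Import GRing.Theory.
Local Open Scope classical_set_scope.

Section Semigroups.
Local Open Scope nat_scope.

Definition is_submonoid (A : set nat) : Prop :=
  A 0 /\ forall x y, A x -> A y -> A (x + y).

(* Cofiniteness is not part of the structure: it is imposed through the
   condition gcd = 1 on the generators. *)
Record semigroup := Semigroup {
  semigroup_set :> set nat;
  semigroup_submonoid : is_submonoid semigroup_set }.

Definition semigroup_gen (G : set nat) : set nat := smallest is_submonoid G.

Definition minimal_generating_set (S : semigroup) (G : set nat) : Prop :=
  semigroup_gen G = S /\
  forall G' : set nat, G' `<=` G -> semigroup_gen G' = S -> G' = G.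

Definition gcd_seq (g : seq nat) : nat := \big[gcdn/0]_(x <- g) x.

(* S = <g_1, ..., g_n> with g = [:: g_1; ...; g_n] and g_1 < ... < g_n *)
Definition numerical_semigroup_on (S : semigroup) (g : seq nat) : Prop :=
  [/\ sorted ltn g, minimal_generating_set S [set` g] & gcd_seq g = 1].

Definition maxM (S : semigroup) : set nat := S `\ 0.

(* The case h = 0 is separate because 0M = S, not {0}. *)
Definition multM (S : semigroup) (h : nat) : set nat :=
  if h is 0 then S
  else [set s | exists2 m : 'I_h -> nat,
                  forall i, maxM S (m i) & s = \sum_(i < h) m i].

Definition Dset (S : semigroup) (g1 h : nat) : set nat :=
  [set s | (multM S h.-1 `\` multM S h) s /\ multM S h.+1 (s + g1)].

End Semigroups.

Local Open Scope ring_scope.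

Section IdealPowers.
Variables (k : fieldType) (R : comAlgType k).

Definition is_ideal (I : set R) : Prop :=
  [/\ I 0, forall x y, I x -> I y -> I (x + y)
     & forall a x, I x -> I (a * x)].

Definition ideal_gen (A : set R) : set R := smallest is_ideal A.

Definition ideal_pow (I : set R) (h : nat) : set R :=
  ideal_gen [set x | exists2 y : 'I_h -> R,
                       forall i, I (y i) & x = \prod_(i < h) y i].

(* dim_k (U / W) = d for k-subspaces W <= U, i.e. some d elements of U induce
   a basis of U / W *)
Definition has_quot_dim (U W : set R) (d : nat) : Prop :=
  exists v : 'I_d -> R,
    [/\ forall i, U (v i),
        forall c : 'I_d -> k,
          W (\sum_(i < d) c i *: v i) -> forall i, c i = 0
      & forall u, U u -> exists c : 'I_d -> k, W (u - \sum_(i < d) c i *: v i)].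

(* The default value 0 for infinite dimension is never used for semigroup rings:
   see hilbert_functionP. *)
Definition quot_dim (U W : set R) : nat :=
  xget 0%N [set d | has_quot_dim U W d].

End IdealPowers.

Section PowerSeries.
Variable k : fieldType.

Record fps := Fps { fps_coef : nat -> k }.

HB.instance Definition _ := gen_eqMixin fps.
HB.instance Definition _ := gen_choiceMixin fps.

Implicit Types f g h : fps.

Lemma fpsP f g : (forall n, fps_coef f n = fps_coef g n) -> f = g.
Proof. by case: f g => [f] [g] /= /funext ->. Qed.

Definition fps_zero := Fps (fun=> 0).
Definition fps_opp f := Fps (fun n => - fps_coef f n).
Definition fps_add f g := Fps (fun n => fps_coef f n + fps_coef g n).

Let addA : associative fps_add.
Proof. by move=> f g h; apply: fpsP => n /=; rewrite addrA. Qed.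
Let addC : commutative fps_add.
Proof. by move=> f g; apply: fpsP => n /=; rewrite addrC. Qed.
Let add0 : left_id fps_zero fps_add.
Proof. by move=> f; apply: fpsP => n /=; rewrite add0r. Qed.
Let addN : left_inverse fps_zero fps_opp fps_add.
Proof. by move=> f; apply: fpsP => n /=; rewrite addNr. Qed.

HB.instance Definition _ := GRing.isZmodule.Build fps addA addC add0 addN.

Definition fps_one := Fps (fun n => (n == 0)%:R).
Definition fps_mul f g :=
  Fps (fun n => \sum_(i < n.+1) fps_coef f i * fps_coef g (n - i)%N).

Let trunc n f : {poly k} := \poly_(i < n.+1) fps_coef f i.

Let coef_trunc n i f : (i <= n)%N -> (trunc n f)`_i = fps_coef f i.
Proof. by move=> lein; rewrite coef_poly ltnS lein. Qed.

Let mulE n i f g : (i <= n)%N ->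
  fps_coef (fps_mul f g) i = (trunc n f * trunc n g)`_i.
Proof.
move=> lein; rewrite coefM; apply: eq_bigr => j _.
by rewrite !coef_trunc // (leq_trans _ lein) ?leq_subr // -ltnS.
Qed.

Let mulA : associative fps_mul.
Proof.
move=> f g h; apply: fpsP => n; transitivity (trunc n f * trunc n g * trunc n h)`_n.
  rewrite -mulrA coefM; apply: eq_bigr => j _; have lejn : (j <= n)%N := leq_ord j.
  by rewrite (coef_trunc f lejn) (mulE g h (leq_subr j n)).
rewrite coefM; apply: eq_bigr => j _; have lejn : (j <= n)%N := leq_ord j.
by rewrite (coef_trunc h (leq_subr j n)) (mulE f g lejn).
Qed.

Let mulC : commutative fps_mul.
Proof. by move=> f g; apply: fpsP => n; rewrite !(mulE _ _ (leqnn n)) mulrC. Qed.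

Let mul1 : left_id fps_one fps_mul.
Proof.
move=> f; apply: fpsP => n /=; rewrite big_ord_recl /= mul1r subn0.
by rewrite big1 ?addr0 // => i _; rewrite mul0r.
Qed.

Let mulDl : left_distributive fps_mul fps_add.
Proof.
move=> f g h; apply: fpsP => n /=; rewrite -big_split /=.
by apply: eq_bigr => i _; rewrite mulrDl.
Qed.

Let one_neq0 : fps_one != 0.
Proof. by apply/eqP => /(congr1 (fps_coef^~ 0%N)) /= /eqP; rewrite oner_eq0. Qed.

HB.instance Definition _ :=
  GRing.Zmodule_isComNzRing.Build fps mulA mulC mul1 mulDl one_neq0.

Definition fps_scale (c : k) f := Fps (fun n => c * fps_coef f n).

Let scaleA a b f : fps_scale a (fps_scale b f) = fps_scale (a * b) f.
Proof. by apply: fpsP => n /=; rewrite mulrA. Qed.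
Let scale1 : left_id 1 fps_scale.
Proof. by move=> f; apply: fpsP => n /=; rewrite mul1r. Qed.
Let scaleDr : right_distributive fps_scale +%R.
Proof. by move=> c f g; apply: fpsP => n /=; rewrite mulrDr. Qed.
Let scaleDl f : {morph fps_scale^~ f : a b / a + b}.
Proof. by move=> a b; apply: fpsP => n /=; rewrite mulrDl. Qed.

HB.instance Definition _ :=
  GRing.Zmodule_isLmodule.Build k fps scaleA scale1 scaleDr scaleDl.

Let scaleAl (c : k) f g : c *: (f * g) = (c *: f) * g.
Proof.
by apply: fpsP => n /=; rewrite mulr_sumr; apply: eq_bigr => i _; rewrite mulrA.
Qed.

HB.instance Definition _ := GRing.Lmodule_isLalgebra.Build k fps scaleAl.
HB.instance Definition _ := GRing.Lalgebra_isComAlgebra.Build k fps.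

Definition fps_Xn (s : nat) : fps := Fps (fun n => (n == s)%:R).

End PowerSeries.

Section SemigroupRing.
Variables (k : fieldType) (S : semigroup).

Definition supported_on : {pred fps k} :=
  fun f => `[< forall n, fps_coef f n != 0 -> semigroup_set S n >].

Let supportedP (f : fps k) :
  reflect (forall n, fps_coef f n != 0 -> semigroup_set S n) (f \in supported_on).
Proof. exact: asboolP. Qed.

Lemma supported_on_subalg : subalg_closed supported_on.
Proof.
split.
- apply/supportedP => -[_|n] /=; last by rewrite eqxx.
  exact: (semigroup_submonoid S).1.
- move=> a f g /supportedP Sf /supportedP Sg; apply/supportedP => n /=.
  apply: contra_neqP => nSn.
  have [/eqP -> | /Sf//] := boolP (fps_coef f n == 0).
  have [/eqP -> | /Sg//] := boolP (fps_coef g n == 0).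
  by rewrite mulr0 addr0.
- move=> f g /supportedP Sf /supportedP Sg; apply/supportedP => n /=.
  apply: contra_neqP => nSn; apply: big1 => i _.
  have [/eqP -> | /Sf Si] := boolP (fps_coef f i == 0); first by rewrite mul0r.
  have [/eqP -> | /Sg Sj] := boolP (fps_coef g (n - i)%N == 0).
    by rewrite mulr0.
  case: nSn; rewrite -(subnKC (leq_ord i)).
  by apply: (semigroup_submonoid S).2.
Qed.

HB.instance Definition _ :=
  GRing.isSubalgClosed.Build k (fps k) supported_on supported_on_subalg.

(* k[[t^S]], as a k-subalgebra of k[[t]] *)
Record semigroup_ring := SemigroupRing {
  series_of :> fps k;
  _ : series_of \in supported_on }.

HB.instance Definition _ := [isSub for series_of].
HB.instance Definition _ := [Choice of semigroup_ring by <:].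
HB.instance Definition _ := [SubChoice_isSubAlgebra of semigroup_ring by <:].
HB.instance Definition _ := [SubNzRing_isSubComNzRing of semigroup_ring by <:].

End SemigroupRing.

Section HilbertFunction.
Variables (k : fieldType) (S : semigroup) (g : seq nat).

(* (t^{g_1}, ..., t^{g_n}) *)
Definition max_ideal : set (semigroup_ring k S) :=
  ideal_gen [set x | exists2 a, a \in g & series_of x = fps_Xn k a].

Definition hilbert_function (h : nat) : nat :=
  quot_dim (ideal_pow max_ideal h) (ideal_pow max_ideal h.+1).

End HilbertFunction.

Section FiniteDimension.
Variables (k : fieldType) (S : semigroup) (g : seq nat).
Hypothesis S_gen : numerical_semigroup_on S g.

Local Notation R := (semigroup_ring k S).
Local Notation coef x n := (fps_coef (series_of x) n).
Local Notation maxI := (@max_ideal k S g).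
Implicit Types (x y : R) (n s a r : nat).

Let S0 : semigroup_set S 0%N := (semigroup_submonoid S).1.
Let SD := (semigroup_submonoid S).2.

Let g_sub a : a \in g -> semigroup_set S a.
Proof. by move=> ga; case: S_gen => _ [<- _] _; apply: sub_gen_smallest. Qed.

Lemma semigroup_gen_submonoid G : is_submonoid (semigroup_gen G).
Proof.
split; first by move=> A [[]].
move=> x y Gx Gy A AG; apply: AG.1.2; [exact: Gx | exact: Gy].
Qed.

Let g_neq0 : 0%N \notin g.
Proof.
apply/negP => g0; case: S_gen => _ [defS minS] _.
have sub : [set` g] `\ 0%N `<=` [set` g] by move=> x [].
suff eqS : semigroup_gen ([set` g] `\ 0%N) = S.
  have : ([set` g] `\ 0%N) 0%N by rewrite (minS _ sub eqS).
  by case=> _; apply.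
rewrite -defS; apply/seteqP; split.
  exact: (sub_smallest2r (semigroup_gen_submonoid _) sub).
apply: smallest_sub; first exact: semigroup_gen_submonoid.
move=> x gx; have [-> | /eqP xn0] := eqVneq x 0%N.
  exact: (semigroup_gen_submonoid _).1.
by apply: sub_gen_smallest.
Qed.

(* sums of h generators and an element of S *)
Fixpoint gsum h s : Prop :=
  if h is h'.+1 then exists2 a, a \in g & exists2 r, gsum h' r & s = (a + r)%N
  else semigroup_set S s.

Let gsumD h a s : semigroup_set S a -> gsum h s -> gsum h (a + s)%N.
Proof.
elim: h s => [|h IH] s Sa /=; first exact: SD.
by case=> b gb [r Er ->]; exists b => //; exists (a + r)%N; [exact: IH | rewrite addnCA].
Qed.

Let maxM_gsum s : maxM S s <-> gsum 1 s.
Proof.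
split=> [[Ss s0] | [a ga [r Sr ->]]]; last first.
  split; first by apply: SD => //; apply: g_sub.
  by move=> /eqP; rewrite addn_eq0 => /andP[/eqP a0 _]; move: g_neq0; rewrite -a0 ga.
suff : [set s | s = 0%N \/ gsum 1 s] s by case.
case: S_gen => _ [defS _] _; move: Ss; rewrite -defS => Ss; apply: Ss; split.
  split=> [|x y]; first by left.
  case=> [-> //|Ex]; case=> [->|Ey]; right; first by rewrite addn0.
  by apply: gsumD => //; case: Ex => a ga [r Sr ->]; apply: SD => //; apply: g_sub.
by move=> x gx; right; exists x => //; exists 0%N => //; rewrite addn0.
Qed.

Lemma multM_gsum h s : multM S h s <-> gsum h s.
Proof.
case: h => [//|h]; elim: h s => [|h IH] s.
  split=> [[m mM ->]|Es]; first by rewrite big_ord1; apply/maxM_gsum.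
  by exists (fun=> s); rewrite ?big_ord1 // => _; apply/maxM_gsum.
split=> [[m mM ->]|[a ga [r Er ->]]].
  rewrite big_ord_recl /=.
  have /maxM_gsum [a ga [r Sr ->]] := mM ord0.
  exists a => //; exists (r + \sum_(i < h.+1) m (lift ord0 i))%N; last by rewrite addnA.
  apply: (@gsumD h.+1) => //; apply/IH; exists (fun i => m (lift ord0 i)) => // i.
have /IH [m mM ->] := Er.
exists (fun i => if unlift ord0 i is Some j then m j else a).
  move=> i; case: unliftP => [j _|_] //; apply/maxM_gsum.
  by exists a => //; exists 0%N => //; rewrite addn0.
rewrite [RHS]big_ord_recl /= unlift_none; congr (_ + _)%N.
by apply: eq_bigr => i _; rewrite liftK.
Qed.

Lemma ideal_gen_ideal (A : set R) : is_ideal (ideal_gen A).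
Proof.
split; first by move=> I [[]].
- by move=> x y Ax Ay I IA; case: (IA) => -[_ + _] _; apply; [exact: Ax | exact: Ay].
- by move=> a x Ax I IA; case: (IA) => -[_ _ +] _; apply; exact: Ax.
Qed.

Lemma ideal_pow_mul (I : set R) h x y :
  I x -> ideal_pow I h y -> ideal_pow I h.+1 (x * y).
Proof.
move=> Ix; have [J0 JD JM] := ideal_gen_ideal [set x | exists2 y : 'I_h.+1 -> R,
                       forall i, I (y i) & x = \prod_(i < h.+1) y i].
move: y; apply: smallest_sub => /=.
  split; first by rewrite mulr0.
    by move=> a b; rewrite mulrDr; apply: JD.
  by move=> a b; rewrite mulrCA; apply: JM.
move=> _ [y Iy ->]; apply: sub_gen_smallest.
exists (fun i => if unlift ord0 i is Some j then y j else x).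
  by move=> i; case: unliftP => [j _|_].
rewrite [RHS]big_ord_recl /= unlift_none; congr (_ * _).
by apply: eq_bigr => i _; rewrite liftK.
Qed.

Let coef0 n : coef (0 : R) n = 0. Proof. by []. Qed.
Let coefD x y n : coef (x + y) n = coef x n + coef y n. Proof. by []. Qed.
Let coefM x y n :
  coef (x * y) n = \sum_(i < n.+1) coef x i * coef y (n - i).
Proof. by []. Qed.
Let coefB x y n : coef (x - y) n = coef x n - coef y n. Proof. by []. Qed.
Let coefZ c x n : coef (c *: x) n = c * coef x n. Proof. by []. Qed.
Let coef_sum (I : Type) (r : seq I) (P : pred I) (F : I -> R) n :
  coef (\sum_(i <- r | P i) F i) n = \sum_(i <- r | P i) coef (F i) n.
Proof. by apply: (big_morph (fun x => coef x n)). Qed.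

Let supp x n : coef x n != 0 -> semigroup_set S n.
Proof. by case: x => x /= /asboolP; apply. Qed.

Let mk (F : nat -> k) : R := insubd (0 : R) (Fps F).
Let coef_mk F n : (forall n, F n != 0 -> semigroup_set S n) -> coef (mk F) n = F n.
Proof. by move=> SF; rewrite -/(val (mk F)) insubdK //; apply/asboolP. Qed.

Let mono s : R := mk (fun n => (n == s)%:R).
Let coef_mono s n : semigroup_set S s -> coef (mono s) n = (n == s)%:R.
Proof. by move=> Ss; rewrite coef_mk // => m; have [->|] := eqVneq m s; rewrite ?eqxx. Qed.

Let coef_monoM s x n : semigroup_set S s ->
  coef (mono s * x) n = if (s <= n)%N then coef x (n - s) else 0.
Proof.
move=> Ss; rewrite coefM; case: leqP => [lesn|ltns].
  have lt : (s < n.+1)%N by [].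
  rewrite (bigD1 (Ordinal lt)) //= coef_mono // eqxx mul1r big1 ?addr0 // => i ni.
  rewrite coef_mono //; case: eqP => [E|]; last by rewrite mul0r.
  by case/eqP: ni; apply: val_inj.
rewrite big1 // => i _; rewrite coef_mono //; case: eqP => [E|]; last by rewrite mul0r.
by move: (leq_ord i); rewrite E leqNgt ltns.
Qed.

Let mono_max a : a \in g -> maxI (mono a).
Proof.
move=> ga; apply: sub_gen_smallest; exists a => //.
by apply: fpsP => n; rewrite coef_mono //; apply: g_sub.
Qed.

Let P h : set R := [set x | forall n, coef x n != 0 -> gsum h n].

Let P_ideal h : is_ideal (P h).
Proof.
split; first by move=> n; rewrite coef0 eqxx.
- move=> x y Px Py n; rewrite coefD => nz.
  have [x0|/Px//] := eqVneq (coef x n) 0; apply: Py; move: nz.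
  by rewrite x0 add0r.
- move=> a x Px n; rewrite coefM; apply: contra_neqP => nE.
  apply: big1 => i _.
  have [->|/supp Si] := eqVneq (coef a i) 0; first by rewrite mul0r.
  have [->|/Px Ei] := eqVneq (coef x (n - i)%N) 0; first by rewrite mulr0.
  by case: nE; rewrite -(subnKC (leq_ord i)); apply: gsumD.
Qed.

Let maxI_P : maxI `<=` P 1.
Proof.
apply: smallest_sub => // x [a ga xa] n; rewrite xa /=.
have [-> _|] := eqVneq n a; last by rewrite eqxx.
by exists a => //; exists 0%N => //; rewrite addn0.
Qed.

Let P_mul h x y : P 1 x -> P h y -> P h.+1 (x * y).
Proof.
move=> Px Py n; rewrite coefM; apply: contra_neqP => nE.
apply: big1 => i _.
have [->|/Px[a ga [r Sr Ei]]] := eqVneq (coef x i) 0; first by rewrite mul0r.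
have [->|/Py Ej] := eqVneq (coef y (n - i)%N) 0; first by rewrite mulr0.
case: nE; rewrite -(subnKC (leq_ord i)) Ei.
exists a => //; exists (r + (n - i))%N; last by rewrite addnA -Ei.
exact: gsumD.
Qed.

Lemma ideal_pow_gsum h : ideal_pow maxI h = P h.
Proof.
apply/seteqP; split.
  apply: smallest_sub => // _ [y my ->].
  elim: h y my => [|h IH] y my; first by move=> n /supp.
  rewrite big_ord_recl; apply: P_mul; first exact: maxI_P.
  by apply: (IH (fun i => y (lift ord0 i))) => i.
elim: h => [|h IH] x Px.
  have [_ _ JM] := ideal_gen_ideal [set x | exists2 y : 'I_0 -> R,
                       forall i, maxI (y i) & x = \prod_(i < 0) y i].
  rewrite -[x]mulr1; apply: JM; apply: sub_gen_smallest.
  by exists (fun=> 0) => [[]//|]; rewrite big_ord0.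
pose D s : set nat := [set a | a \in g /\ exists2 r, gsum h r & s = (a + r)%N].
pose l s := xget 0%N (D s).
pose F a n := if `[< D (a + n)%N a >] && (l (a + n)%N == a) then coef x (a + n)%N else 0.
have gsumS j n : gsum j n -> semigroup_set S n.
  elim: j n => //= j IHj n [a ga [r Er ->]]; apply: SD; [exact: g_sub | exact: IHj].
have FE a n : F a n != 0 -> gsum h n.
  rewrite /F; case: ifP => [/andP[/asboolP[_ [r Er /addnI ->]]] //|].
  by rewrite eqxx.
have -> : x = \sum_(a <- g) mono a * mk (F a).
  apply/val_inj/fpsP => n; rewrite [RHS]coef_sum.
  have [x0|xn0] := eqVneq (coef x n) 0.
    rewrite [LHS]x0 big_seq big1 // => a ga; rewrite (coef_monoM _ _ (g_sub ga)).
    case: leqP => // lean; rewrite coef_mk => [|m /FE/gsumS //].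
    by rewrite /F subnKC // x0 if_same.
  have Dl : D n (l n).
    by apply: xgetPex; case: (Px _ xn0) => a ga [r Er En]; exists a; split=> //; exists r.
  have [gl [r Er En]] := Dl.
  have lel : (l n <= n)%N by rewrite {2}En leq_addr.
  rewrite (bigD1_seq (l n)) //; last first.
    by case: S_gen => /(sorted_uniq ltn_trans ltnn).
  rewrite (coef_monoM _ _ (g_sub gl)) lel coef_mk => [|m /FE/gsumS //].
  rewrite /F subnKC // eqxx andbT (asboolT Dl) big_seq_cond big1; first by rewrite [RHS]addr0.
  move=> a /andP[ga nal].
  rewrite (coef_monoM _ _ (g_sub ga)); case: leqP => // lean.
  rewrite coef_mk => [|m /FE/gsumS //].
  by rewrite /F subnKC // eq_sym (negPf nal) andbF.
have [J0 JD _] := ideal_gen_ideal [set x | exists2 y : 'I_h.+1 -> R,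
                       forall i, maxI (y i) & x = \prod_(i < h.+1) y i].
rewrite big_seq; apply: (big_ind (ideal_pow maxI h.+1)) => // a ga.
apply: ideal_pow_mul; first exact: mono_max.
by apply: IH => n; rewrite coef_mk => [/FE|m /FE/gsumS].
Qed.

Fixpoint sums h : seq nat :=
  if h is h'.+1 then [seq (a + s)%N | a <- g, s <- sums h'] else [:: 0%N].

Let gsum_sums h s : gsum h s -> ~ gsum h.+1 s -> s \in sums h.
Proof.
elim: h s => [|h IH] s.
  move=> Ss nE; rewrite inE; apply/eqP; apply: contra_notP nE => s0.
  by apply/maxM_gsum.
case=> a ga [r Er ->] nE; apply/allpairsP; exists (a, r); split=> //=.
by apply: IH => // Er'; apply: nE; exists a => //; exists r.
Qed.

Lemma hilbert_functionP h :
  has_quot_dim (ideal_pow maxI h) (ideal_pow maxI h.+1) (hilbert_function k S g h).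
Proof.
apply: xgetPex; rewrite !ideal_pow_gsum.
pose b := [seq s <- undup (sums h) | `[< gsum h s /\ ~ gsum h.+1 s >]].
have b_uniq : uniq b by rewrite filter_uniq ?undup_uniq.
have inb s : s \in b <-> gsum h s /\ ~ gsum h.+1 s.
  rewrite mem_filter mem_undup; split=> [/andP[/asboolP]//|[Es nEs]].
  by rewrite (gsum_sums Es nEs) andbT; apply/asboolP.
have gsumS j n : gsum j n -> semigroup_set S n.
  elim: j n => //= j IHj n [a ga [r Er ->]]; apply: SD; [exact: g_sub | exact: IHj].
have bi (i : 'I_(size b)) : nth 0%N b i \in b by apply: mem_nth.
have bS (i : 'I_(size b)) : semigroup_set S (nth 0%N b i).
  by have /inb[/gsumS] := bi i.
pose v (i : 'I_(size b)) := mono (nth 0%N b i).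
have coefv c n : coef (\sum_(i < size b) c i *: v i) n =
    \sum_(i < size b | n == nth 0%N b i) c i.
  rewrite coef_sum [RHS]big_mkcond; apply: eq_bigr => i _.
  by rewrite coefZ coef_mono //; case: eqP; rewrite ?mulr1 ?mulr0.
have coefvi c (i : 'I_(size b)) :
    coef (\sum_(i < size b) c i *: v i) (nth 0%N b i) = c i.
  rewrite coefv (big_pred1 i) // => j /=; rewrite nth_uniq //.
  by rewrite eq_sym.
exists (size b), v; split=> [i n|c Wc i|u Uu].
- rewrite coef_mono //; have [-> _|] := eqVneq n (nth 0%N b i); last by rewrite eqxx.
  by have /inb[] := bi i.
- have /inb[_ nE] := bi i; apply/eqP; apply: contra_notT nE => ci.
  by apply: Wc; rewrite coefvi.
- exists (fun i => coef u (nth 0%N b i)) => n; rewrite coefB => nz.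
  have [nb|nb] := boolP (n \in b).
    have lt : (index n b < size b)%N by rewrite index_mem.
    have := coefvi (fun i => coef u (nth 0%N b i)) (Ordinal lt).
    by rewrite /= nth_index // => E; rewrite E subrr eqxx in nz.
  rewrite coefv big1 ?subr0 in nz; last first.
    by move=> i /eqP E; rewrite E bi in nb.
  by apply: contra_notP (negP nb) => nE; apply/inb; split=> //; apply: Uu.
Qed.

End FiniteDimension.

(* Main.v *)
Require Import Defs.
From mathcomp Require Import all_boot all_order all_algebra.
From mathcomp Require Import boolp classical_sets functions cardinality.
From mathcomp Require Import zify.
Local Open Scope classical_set_scope.
Local Open Scope card_scope.
Local Open Scope nat_scope.

(** Write g1 for the smallest generator and B_h for the set of elements of
    order h, those lying in hM but not in (h+1)M.  The h-th power of the
    maximal ideal consists of the series supported in hM, so H_R(h) = |B_h|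
    ([hilbert_function_size]), and everything takes place inside S.

    Translation by g1 maps B_(h-1) injectively into hM, and only the elements
    of D_h are sent outside B_h.  What the translation misses in B_h is
    C_h = {c in B_h : c - g1 not in (h-1)M}, hence
    H_R(h) - H_R(h-1) = |C_h| - |D_h|, and it is enough to show that
    |D_h| <= h+1 implies |D_h| <= |C_h| ([D_size_le_C_size]).

    Two facts about D_h + g1 give this.  Its elements have order at least h+1
    and form an antichain for divisibility in S: if s' = s + r with r in M and
    s in (h-1)M then s' lies in hM, so s' is not in D_h.  Moreover, if an
    element of D_h + g1 is written with as many generators as possible, then
    all its partial sums with h terms lie in C_h.  So one wants to push the
    antichain down to degree h without losing elements, which is a statement
    about shadows: a set T of sums of d generators with |T| <= d has at least
    |T| elements in its shadow, the set of sums of d-1 generators obtained by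
    deleting one term ([shadow_size]).  This is the easy range of Macaulay's
    growth theorem, and the bound h+1 on |D_h| is what keeps the antichain in
    that range at every degree above h.  Replacing repeatedly the top degree
    of the antichain by part of its shadow ends with a subset of C_h
    ([antichain_size]).

    The shadow bound comes from an exchange argument
    ([exchange_closed_size]): if no element of T had a private element in its
    shadow, every term of every sum could be exchanged for a different one
    inside T, and this forces |T| > d. *)

(** * Shadows of sets of sums of generators *)

Lemma mem_sumsS (g : seq nat) d n :
  n \in sums g d.+1 <-> exists2 x, x \in g & exists2 u, u \in sums g d & n = x + u.
Proof.
split=> [/allpairsP[[x u] [/= gx su ->]]|[x gx [u su ->]]].
  by exists x => //; exists u.
exact: allpairs_f.
Qed.

Lemma sumsD (g : seq nat) i j x y :
  x \in sums g i -> y \in sums g j -> x + y \in sums g (i + j).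
Proof.
elim: i x => [|i IH] x; first by rewrite inE => /eqP ->.
move=> /mem_sumsS[a ga [u su ->]] sy; rewrite -addnA addSn.
by apply/mem_sumsS; exists a => //; exists (u + y) => //; apply: IH.
Qed.

Lemma sums_muln (g : seq nat) e x : x \in g -> e * x \in sums g e.
Proof.
move=> gx; elim: e => [|e IH]; first by rewrite inE.
by rewrite mulSn; apply/mem_sumsS; exists x => //; exists (e * x).
Qed.

(** Induction on d.  Let x be the smallest generator that can be removed from
    an element of T, and e the largest multiplicity with which x can be
    removed.  The elements of T from which e * x can be removed are, after that
    removal, exchange closed in degree d - e: an exchange within them cannot
    bring in a further x, by maximality of e.  So there are more than d - e of
    them.  Starting from the largest of these and exchanging the e copies of x
    one after the other gives a chain of e strictly increasing elements, since
    x is exchanged for larger generators; these are all new. *)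
Lemma exchange_closed_size (g : seq nat) d (T : seq nat) :
  uniq T -> T != [::] -> {subset T <= sums g d} ->
  (forall d' x u, d = d'.+1 -> x \in g -> u \in sums g d' -> x + u \in T ->
     exists y, [/\ y \in g, y != x & y + u \in T]) ->
  d < size T.
Proof.
have [m] := ubnP d; elim: m d T => // m IHm [|d] T ltdm uT nT sT exT.
  by case: T nT {uT sT exT}.
have exQ : exists x, (x \in g) && has (fun t => (x <= t) && (t - x \in sums g d)) T.
  case: T nT sT {uT exT} => // t T _ sT.
  have /mem_sumsS[x gx [u su tE]] := sT t (mem_head _ _).
  by exists x; rewrite gx /= tE leq_addr addKn su.
pose x := ex_minn exQ.
have [gx [t1 Tt1 /andP[lex1 sx1]] minx] : [/\ x \in g,
    exists2 t, t \in T & (x <= t) && (t - x \in sums g d) &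
    forall y u, y \in g -> u \in sums g d -> y + u \in T -> x <= y].
  rewrite /x; case: ex_minnP => z /andP[gz /hasP[t Tt tz]] minz; split=> //.
    by exists t.
  move=> y u gy su Tyu; apply: minz; rewrite gy; apply/hasP; exists (y + u) => //.
  by rewrite leq_addr addKn su.
clearbody x; clear exQ.
pose xpow e t := (e * x <= t) && (t - e * x \in sums g (d.+1 - e)).
pose Q e := (e <= d.+1) && has (xpow e) T.
have exE : exists e, Q e.
  by exists 1; rewrite /Q /=; apply/hasP; exists t1; rewrite // /xpow mul1n lex1 subn1.
have bndE e : Q e -> e <= d.+1 by case/andP.
pose e := ex_maxn exE bndE.
have [led [t0 Tt0 xt0] maxe] : [/\ e <= d.+1, exists2 t, t \in T & xpow e t &
    forall i, i <= d.+1 -> has (xpow i) T -> i <= e].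
  rewrite /e; case: ex_maxnP => i /andP[lei /hasP[t Tt xt]] maxi; split=> //.
    by exists t.
  by move=> j lej xj; apply: maxi; rewrite /Q lej.
clearbody e; clear exE bndE Q.
have e_gt0 : 0 < e.
  by apply: maxe => //; apply/hasP; exists t1; rewrite // /xpow mul1n lex1 subn1.
pose T1 := [seq t <- T | xpow e t].
pose T2 := [seq t - e * x | t <- T1].
have T2E u : u \in T2 -> u \in sums g (d.+1 - e) /\ e * x + u \in T.
  case/mapP => t; rewrite mem_filter => /andP[/andP[let_ st] Tt] ->.
  by rewrite subnKC.
have inT2 u : u \in sums g (d.+1 - e) -> e * x + u \in T -> u \in T2.
  move=> su Tu; apply/mapP; exists (e * x + u); last by rewrite addKn.
  by rewrite mem_filter Tu andbT /xpow leq_addr addKn.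
have uT2 : uniq T2.
  rewrite map_inj_in_uniq ?filter_uniq // => a b.
  by rewrite !mem_filter => /andP[/andP[lea _] _] /andP[/andP[leb _] _]; lia.
have szT1 : d.+1 - e < size T1.
  rewrite -(size_map (fun t => t - e * x)); apply: (IHm _ T2) => //; first by lia.
  - have : t0 - e * x \in T2.
      by apply/mapP; exists t0; rewrite // mem_filter xt0.
    by case: (T2).
  - by move=> u /T2E[].
  - move=> d' z u dE gz su Tzu.
    have {}dE : d = e + d' by lia.
    have sxu : e * x + u \in sums g d by rewrite dE; apply: sumsD => //; apply: sums_muln.
    have [|y [gy yz Ty]] := exT d z (e * x + u) erefl gz sxu.
      by rewrite addnCA; have [] := T2E _ Tzu.
    exists y; split=> //; apply: inT2; last by rewrite addnCA.
    have -> : d.+1 - e = d'.+1 by rewrite dE -addnS addKn.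
    by apply/mem_sumsS; exists y => //; exists u.
pose t := \max_(t <- T1) t.
have T1t : t \in T1.
  have : T1 != [::] by case: (T1) szT1.
  rewrite /t; elim: (T1) => // a [|b s] IHs _; first by rewrite big_seq1 mem_head.
  rewrite big_cons /maxn; case: ifP => _; last exact: mem_head.
  by rewrite in_cons IHs ?orbT.
have T1_le s : s \in T1 -> s <= t by move=> ?; apply: (@leq_bigmax_seq _ _ predT id).
have [Tt xt] : t \in T /\ xpow e t by move: T1t; rewrite mem_filter => /andP[].
(* After k exchanges: the current element s still has e - k removable copies of
   x, and l lists the k elements of T above t met so far. *)
have chain k : k <= e -> exists s l, [/\ s \in T, t <= s,
    exists2 v, v \in sums g (d.+1 - e + k) & s = (e - k) * x + v,
    uniq l /\ size l = k & forall r, r \in l -> [/\ r \in T, t < r & r <= s]].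
  elim: k => [|k IHk] lek.
    exists t, [::]; split=> //; exists (t - e * x); rewrite ?addn0 ?subn0 ?subnKC //.
      by case/andP: xt.
    by case/andP: xt.
  have [s [l [Ts lets [v sv sE] [ul szl] lP]]] := IHk (ltnW lek).
  have su : (e - k.+1) * x + v \in sums g d.
    have -> : d = (e - k.+1) + (d.+1 - e + k) by clear - lek led; lia.
    by apply: sumsD => //; apply: sums_muln.
  have sE' : s = x + ((e - k.+1) * x + v).
    by rewrite sE addnA -mulSn; congr (_ * _ + _); clear - lek; lia.
  have [|y [gy yx Ty]] := exT d x _ erefl gx su; first by rewrite -sE'.
  have ltxy : x < y.
    have := minx y _ gy su Ty; rewrite leq_eqVlt eq_sym (negPf yx); exact.
  exists (y + ((e - k.+1) * x + v)), (y + ((e - k.+1) * x + v) :: l).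
  split=> //; first by clear - sE' lets ltxy; lia.
  - exists (y + v); last by rewrite addnCA.
    by rewrite addnS; apply/mem_sumsS; exists y => //; exists v.
  - split; last by rewrite /= szl.
    by rewrite /= ul andbT; apply/negP => /lP[_ _]; clear - sE' ltxy; lia.
  - move=> r; rewrite in_cons => /orP[/eqP ->|/lP[Tr ltr ler]]; split=> //.
      by clear - sE' lets ltxy; lia.
    by clear - sE' ler ltxy; lia.
have [s [l [_ _ _ [ul szl] lP]]] := chain e (leqnn e).
suff : size (T1 ++ l) <= size T by rewrite size_cat szl; clear - szT1 led; lia.
apply: uniq_leq_size.
  rewrite cat_uniq filter_uniq // ul andbT /=; apply/hasPn => r /lP[_ ltr _].
  by apply/negP => /T1_le; rewrite leqNgt ltr.
move=> r; rewrite mem_cat => /orP[|/lP[]//].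
by rewrite mem_filter => /andP[].
Qed.

(** The set [U] is part of the shadow of [T].  By [exchange_closed_size] some
    element [x + u] of [T] cannot be exchanged inside [T] at the term [x]; then
    [u] is in the shadow of no other element of [T], and induction applies to
    the remaining ones. *)
Lemma shadow_size (g : seq nat) d (T : seq nat) :
  uniq T -> {subset T <= sums g d.+1} -> size T <= d.+1 ->
  exists U, [/\ uniq U, size U = size T &
    forall u, u \in U -> u \in sums g d /\ exists2 x, x \in g & x + u \in T].
Proof.
move: {2}(size T) (erefl (size T)) => m; elim: m T => [|m IHm] T szT uT sT leT.
  by exists [::]; rewrite szT.
have [x [u [gx su Txu noy]]] : exists x u, [/\ x \in g, u \in sums g d, x + u \in T &
    forall y, y \in g -> y + u \in T -> y = x].
  apply: contrapT => noex; move: leT; apply/negP; rewrite -ltnNge.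
  apply: (@exchange_closed_size g) => //; first by case: (T) szT.
  move=> _ x u [<-] gx su Txu; apply: contrapT => noy; apply: noex.
  exists x, u; split=> // y gy Ty; apply/eqP/negP => /negP yx.
  by apply: noy; exists y.
have szr : size (rem (x + u) T) = m by rewrite size_rem // szT.
have [||V [uV szV VP]] := IHm _ szr (rem_uniq _ uT).
- by move=> t /mem_rem /sT.
- by rewrite szr; lia.
exists (u :: V); split.
- rewrite /= uV andbT; apply/negP => /VP[_ [y gy Ty]].
  have yx := noy y gy (mem_rem Ty).
  by move: Ty; rewrite yx mem_rem_uniqF.
- by rewrite /= szV szr szT.
- move=> w; rewrite in_cons => /orP[/eqP ->|/VP[sw [y gy Ty]]].
    by split=> //; exists x.
  by split=> //; exists y => //; apply: mem_rem Ty.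
Qed.

(** The antichain [A] consists of pairs (degree, sum), because the same number
    may be a sum of generators in several lengths; [m] bounds the spread of the
    degrees and serves for the induction.  The elements of top degree are
    replaced by as many elements of their shadow: the result is again an
    antichain, and its size is unchanged since an element of [A] that
    was already in this shadow would lie below an element of top degree.  The
    hypothesis [size A <= h.+1] makes [shadow_size] applicable, the top degree
    being at least [h.+1] until everything sits in degree [h]. *)
Lemma antichain_size (g : seq nat) m h (A : seq (nat * nat)) (K : seq nat) :
  uniq A -> size A <= h.+1 ->
  (forall j n, (j, n) \in A -> [/\ h <= j, j <= h + m & n \in sums g j]) ->
  (forall i a e r, (i, a) \in A -> r \in sums g e.+1 ->
     (i + e.+1, a + r) \notin A) ->
  (forall c e r, c \in sums g h -> r \in sums g e -> (h + e, c + r) \in A ->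
     c \in K) ->
  size A <= size K.
Proof.
elim: m A => [|m IHm] A uA szA sA antiA KA.
  rewrite -(size_map snd); apply: uniq_leq_size.
    rewrite map_inj_in_uniq // => -[i a] [j b] /sA[hi ih _] /sA[hj jh _] /= ->.
    by congr (_, _); lia.
  move=> n /mapP[[j a] Aja /= ->]; have [hj jh sa] := sA _ _ Aja.
  have jE : j = h by lia.
  by apply: (KA a 0 0) => //; rewrite ?addn0 -jE.
pose N := h + m.
pose top (p : nat * nat) := p.1 == N.+1.
pose T := [seq p.2 | p <- [seq p <- A | top p]].
have TP n : n \in T <-> (N.+1, n) \in A.
  split=> [/mapP[[j a]]|An]; first by rewrite mem_filter => /andP[/eqP /= -> ?] ->.
  by apply/mapP; exists (N.+1, n); rewrite // mem_filter An andbT /top /=.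
have szT : size T = count top A by rewrite size_map size_filter.
have [|||U [uU szU UP]] := @shadow_size g N T.
- rewrite map_inj_in_uniq ?filter_uniq // => -[i a] [j b].
  by rewrite !mem_filter /top /= => /andP[/eqP -> _] /andP[/eqP -> _] ->.
- by move=> n /TP/sA[].
- by rewrite szT; apply: leq_trans (count_size _ _) _; apply: leq_trans szA _; rewrite /N; lia.
pose A' := [seq p <- A | ~~ top p] ++ [seq (N, u) | u <- U].
have A'P j n : (j, n) \in A' -> ((j, n) \in A /\ j <= N) \/ (j = N /\ n \in U).
  rewrite mem_cat => /orP[|/mapP[u Uu [-> ->]]]; last by right.
  rewrite mem_filter /top /= => /andP[jN Ajn]; left; split=> //.
  by have [_ + _] := sA _ _ Ajn; rewrite /N in jN *; lia.
(* No element of A divides an element of U: it would also divide an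
   element of top degree. *)
have shadow_anti u x e r : u \in U -> u = x + r -> r \in sums g e -> (N - e, x) \in A -> e <= N -> False.
  move=> Uu uE sr Ax leN; have [_ [y gy /TP Ay]] := UP u Uu.
  have sry : y + r \in sums g e.+1 by apply/mem_sumsS; exists y => //; exists r.
  have /negP := antiA _ _ e _ Ax sry; apply.
  have -> : N - e + e.+1 = N.+1 by lia.
  by have -> : x + (y + r) = y + u by lia.
suff: size A' <= size K.
  by rewrite size_cat size_map szU szT size_filter addnC -(count_predC top A).
have szA' : size A' = size A.
  by rewrite size_cat size_map szU szT size_filter addnC -(count_predC top A).
apply: IHm.
- rewrite cat_uniq filter_uniq // (map_inj_uniq (fun a b (E : (N, a) = (N, b)) => congr1 snd E)).
  rewrite uU andbT /=; apply/hasPn => _ /mapP[u Uu ->]; rewrite mem_filter.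
  apply/negP => /andP[_ Au]; apply: (shadow_anti u u 0 0) => //; by rewrite ?addn0 ?subn0.
- by rewrite szA'.
- move=> j n /A'P[[Ajn jN]|[-> Un]].
    by have [? _ ?] := sA _ _ Ajn.
  by have [? _] := UP n Un; split=> //; rewrite /N; lia.
- move=> i a e r A'a sr; apply/negP => /A'P[[Aar leN]|[NE Uar]].
    case/A'P: A'a => [[Aa _]|[iN _]]; last by lia.
    by move: Aar; apply/negP/antiA.
  case/A'P: A'a => [[Aa leN]|[iN _]]; last by lia.
  by apply: (shadow_anti (a + r) a e.+1 r) => //; [have -> : N - e.+1 = i by lia | lia].
- move=> c e r sc sr /A'P[[Acr _]|[NE Ucr]]; first exact: (KA c e r).
  have [_ [y gy /TP Ay]] := UP _ Ucr.
  apply: (KA c e.+1 (y + r)) => //; first by apply/mem_sumsS; exists y => //; exists r.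
  by rewrite addnS NE addnCA.
Qed.

(** * Elements of given order in a numerical semigroup *)

Definition order_layer (S : semigroup) (g : seq nat) h : seq nat :=
  [seq s <- undup (sums g h) | `[< gsum S g h s /\ ~ gsum S g h.+1 s >]].

(** This is D_(h+1): see [Dset_Dlist]. *)
Definition Dlist (S : semigroup) (g : seq nat) h : seq nat :=
  [seq s <- order_layer S g h | `[< gsum S g h.+2 (s + head 0 g) >]].

(** This is C_(h+1), which indexes a basis of the degree h+1 component of the
    associated graded ring modulo the initial form of t^(g_1). *)
Definition Clist (S : semigroup) (g : seq nat) h : seq nat :=
  [seq c <- order_layer S g h.+1 |
     ~~ `[< exists2 s, gsum S g h s & c = s + head 0 g >]].

Section Orders.
Import GRing.Theory.
Context {S : semigroup} {g : seq nat} (S_gen : numerical_semigroup_on S g).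

Let SD := (semigroup_submonoid S).2.
Let g1 := head 0 g.

Lemma gen_semigroup a : a \in g -> semigroup_set S a.
Proof. by move=> ga; case: S_gen => _ [<- _] _; apply: sub_gen_smallest. Qed.

Lemma gen_gt0 a : a \in g -> 0 < a.
Proof.
move=> ga; have /(multM_gsum S_gen)[m mM ->] : gsum S g 1 a.
  exists a => //; exists 0; rewrite ?addn0 //; exact: (semigroup_submonoid S).1.
by rewrite big_ord1 lt0n; apply/eqP; case: (mM ord0).
Qed.

Lemma head_gen : head 0 g \in g.
Proof.
by case: S_gen => _ _; case: (g) => [|a s _]; rewrite ?mem_head // /gcd_seq big_nil.
Qed.

Lemma gsum_semigroup h s : gsum S g h s -> semigroup_set S s.
Proof.
elim: h s => // h IH s [a ga [r /IH Sr ->]]; apply: SD => //; exact: gen_semigroup.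
Qed.

Lemma gsumD i j x y : gsum S g i x -> gsum S g j y -> gsum S g (i + j) (x + y).
Proof.
elim: i x => [|i IH] x /=; last first.
  by case=> a ga [r gr ->] gy; exists a => //; exists (r + y); rewrite ?addnA //; apply: IH.
move=> Sx; rewrite add0n; elim: j y => [|j IH] y /=; first exact: SD.
by case=> a ga [r gr ->]; exists a => //; exists (x + r); [exact: IH | rewrite addnCA].
Qed.

Lemma gsum_leq i j s : i <= j -> gsum S g j s -> gsum S g i s.
Proof.
move=> /subnK <-; elim: (j - i) s => // d IH s [a ga [r /IH gr ->]].
by apply: (@gsumD 0 _ _ _) => //; apply: gen_semigroup.
Qed.

Lemma sums_gsum h s : s \in sums g h -> gsum S g h s.
Proof.
elim: h s => [|h IH] s; last first.
  by move=> /mem_sumsS[a ga [u /IH su ->]]; exists a => //; exists u.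
by rewrite inE => /eqP ->; exact: (semigroup_submonoid S).1.
Qed.

(** An element of order exactly [h] has no room for a nonzero remainder after
    its [h] generators; this makes the layers finite and allows the shadow
    argument, which concerns sums of generators only. *)
Lemma exact_gsum_sums h s : gsum S g h s -> ~ gsum S g h.+1 s -> s \in sums g h.
Proof.
elim: h s => [|h IH] s.
  move=> Ss n1; rewrite inE; apply/eqP; apply: contra_notP n1 => s0.
  apply/(multM_gsum S_gen 1); exists (fun=> s); last by rewrite big_ord1.
  by move=> _; split.
case=> a ga [r gr ->] nE; apply/mem_sumsS; exists a => //; exists r => //.
by apply: IH => // gr'; apply: nE; exists a => //; exists r.
Qed.

(** The order is finite because generators are positive. *)
Lemma gsum_order h s : gsum S g h s ->
  exists j, [/\ h <= j, gsum S g j s & ~ gsum S g j.+1 s].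
Proof.
have gsum_le j r : gsum S g j r -> j <= r.
  elim: j r => // j IH r [a /gen_gt0 a0 [u /IH ju ->]]; lia.
move=> ghs.
have exP : exists j, `[< gsum S g j s >] by exists h; apply/asboolP.
have bndP j : `[< gsum S g j s >] -> j <= s by move=> /asboolP /gsum_le.
case: (ex_maxnP exP bndP) => j /asboolP gj maxj; exists j; split=> //.
  by apply: maxj; apply/asboolP.
by move=> gj1; have /maxj := asboolT gj1; rewrite ltnn.
Qed.

Lemma order_layer_uniq h : uniq (order_layer S g h).
Proof. by rewrite filter_uniq ?undup_uniq. Qed.

Lemma order_layerP h s :
  s \in order_layer S g h <-> gsum S g h s /\ ~ gsum S g h.+1 s.
Proof.
rewrite mem_filter mem_undup; split=> [/andP[/asboolP]//|[gs ngs]].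
by rewrite (exact_gsum_sums _ _ gs ngs) andbT; apply/asboolP.
Qed.

Lemma Dset_Dlist h : Dset S (head 0 g) h.+1 = [set` Dlist S g h].
Proof.
apply/seteqP; split=> s; rewrite /Dset /= mem_filter.
  move=> [[gs ngs] gs1]; apply/andP; split.
    by apply/asboolP; apply: (multM_gsum S_gen h.+2 _).1.
  apply/order_layerP; split; first exact: (multM_gsum S_gen h s).1.
  by move=> ?; apply: ngs; apply: (multM_gsum S_gen h.+1 s).2.
move=> /andP[/asboolP gs1 /order_layerP[gs ngs]].
split; last exact: (multM_gsum S_gen h.+2 _).2.
split; first exact: (multM_gsum S_gen h s).2.
by move=> ?; apply: ngs; apply: (multM_gsum S_gen h.+1 s).1.
Qed.

(** * Comparison of consecutive layers *)

(** [antichain_size] is applied in degree [h.+1] to the translate of D_(h+1),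
    each element being placed in the degree equal to its order. *)
Lemma D_size_le_C_size h : size (Dlist S g h) <= h.+2 ->
  size (Dlist S g h) <= size (Clist S g h).
Proof.
move=> szD.
have /choice[ord ordP] s : exists j, s \in Dlist S g h ->
    [/\ h.+2 <= j, gsum S g j (s + g1) & ~ gsum S g j.+1 (s + g1)].
  have [|sD] := boolP (s \in Dlist S g h); last by exists 0.
  by rewrite mem_filter => /andP[/asboolP /gsum_order[j jP] _]; exists j.
pose A := [seq (ord s, s + g1) | s <- Dlist S g h].
have AP j n : (j, n) \in A -> exists s, [/\ gsum S g h s, ~ gsum S g h.+1 s,
    n = s + g1, h.+2 <= j & gsum S g j n /\ ~ gsum S g j.+1 n].
  case/mapP => s Ds [-> ->]; have [hs gs ngs] := ordP _ Ds.
  move: Ds; rewrite mem_filter => /andP[_ /order_layerP[ghs nghs]].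
  by exists s.
have le_m : forall s, s \in Dlist S g h -> ord s <= h.+1 + \max_(s <- Dlist S g h) ord s.
  by move=> s Ds; rewrite (leq_trans _ (leq_addl _ _)) // (@leq_bigmax_seq _ _ predT ord).
rewrite -(size_map (fun s => (ord s, s + g1))).
apply: (@antichain_size g (\max_(s <- Dlist S g h) ord s) h.+1).
- rewrite map_inj_in_uniq ?filter_uniq ?undup_uniq // => s s' _ _ [_ /addIn //].
- by rewrite size_map.
- move=> j n Ajn; have [s [_ _ _ hj [gj ngj]]] := AP _ _ Ajn; split.
  + exact: ltnW.
  + by case/mapP: Ajn => s' Ds' [-> _]; apply: le_m.
  + exact: exact_gsum_sums.
- (* s' = s + r with r a sum of e+1 generators would lie in (h+1)M. *)
  move=> i a e r /AP[s [gs _ aE _ _]] /sums_gsum gr; apply/negP.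
  case/AP => s' [_ ngs' s'E _ _]; apply: ngs'.
  have -> : s' = s + r by lia.
  by apply: (@gsum_leq _ (h + e.+1)); [lia | exact: gsumD].
- (* If c = c' + g1 with c' in hM, then s = c' + r, and r is a sum of e >= 1
     generators, so s would lie in (h+1)M. *)
  move=> c e r sc /sums_gsum gr /AP[s [gs ngs crE he [gcr ngcr]]].
  have gc := sums_gsum _ _ sc.
  rewrite mem_filter; apply/andP; split.
    apply/negP => /asboolP[c' gc' cE]; apply: ngs.
    have -> : s = c' + r by lia.
    by apply: (@gsum_leq _ (h + e)); [lia | exact: gsumD].
  by apply/order_layerP; split=> // gc1; apply: ngcr; rewrite -addSn; apply: gsumD.
Qed.

(** Translation by g1 injects the complement of D_(h+1) in the layer of order
    [h] into the complement of C_(h+1) in the next layer. *)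
Lemma order_layer_size_le h : size (Dlist S g h) <= size (Clist S g h) ->
  size (order_layer S g h) <= size (order_layer S g h.+1).
Proof.
move=> leDC.
pose inD s := `[< gsum S g h.+2 (s + head 0 g) >].
pose inC c := ~~ `[< exists2 s, gsum S g h s & c = s + head 0 g >].
rewrite -(count_predC inD) -[leqRHS](count_predC inC) -!size_filter.
rewrite leq_add // -(size_map (addn^~ g1)); apply: uniq_leq_size.
  rewrite map_inj_uniq ?filter_uniq ?undup_uniq //; exact: addIn.
move=> _ /mapP[s + ->]; rewrite mem_filter /= => /andP[/asboolPn ngs1 /order_layerP[gs ngs]].
rewrite mem_filter /= negbK; apply/andP; split; first by apply/asboolP; exists s.
apply/order_layerP; split=> //.
exists g1; first exact: head_gen.
by exists s; rewrite // addnC.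
Qed.

(** * The Hilbert function *)

(** The dimension is only known through some basis [v] of the quotient, so it
    has to be compared with the monomial one.  Membership in a power of the
    maximal ideal depends only on the support of a series, so the class of a
    series modulo the next power is determined by its coefficients at the
    elements of the layer.  The matrix of these coefficients for [v] has free
    rows because [v] is independent, and full row space because [v] spans the
    monomials; hence it is square. *)
Lemma hilbert_function_size (k : fieldType) h :
  hilbert_function k S g h = size (order_layer S g h).
Proof.
have := hilbert_functionP k S_gen h; rewrite !(ideal_pow_gsum k S_gen).
set d := hilbert_function k S g h; case=> v [Uv free_v span_v].
set b := order_layer S g h.
pose R := semigroup_ring k S.
pose coef (x : R) n := fps_coef (series_of x) n.
have coef_comb (c : 'I_d -> k) n :
    coef (\sum_(i < d) c i *: v i)%R n = (\sum_(i < d) c i * coef (v i) n)%R.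
  by apply: (big_morph (fun x : R => coef x n)).
have bE (j : 'I_(size b)) : gsum S g h (nth 0 b j) /\ ~ gsum S g h.+1 (nth 0 b j).
  by apply/order_layerP; apply: mem_nth.
have coef_b n : gsum S g h n -> ~ gsum S g h.+1 n ->
    exists j : 'I_(size b), n = nth 0 b j.
  move=> gn ngn; have nb : n \in b by apply/order_layerP.
  have lt : index n b < size b by rewrite index_mem.
  by exists (Ordinal lt); rewrite /= nth_index.
pose A := (\matrix_(i < d, j < size b) coef (v i) (nth 0 b j))%R.
have freeA : row_free A.
  apply: inj_row_free => w wA0; apply/rowP => i; rewrite mxE.
  apply: (free_v (w ord0)) => n nz; apply: contrapT => ngn.
  have gn : gsum S g h n.
    apply: contrapT => nghn; move/eqP: nz; apply; rewrite -/(coef _ n) coef_comb.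
    rewrite big1 // => l _; have [->|/Uv //] := eqVneq (coef (v l) n) 0%R.
    by rewrite mulr0.
  have [j nE] := coef_b n gn ngn.
  move/eqP: nz; apply; rewrite -/(coef _ n) coef_comb.
  have /rowP/(_ j) := wA0; rewrite !mxE => E; apply: etrans E.
  by apply: eq_bigr => l _; rewrite mxE nE.
have fullA : row_full A.
  have mono_in s : semigroup_set S s -> fps_Xn k s \in @supported_on k S.
    by move=> Ss; apply/asboolP => n /=; have [->|] := eqVneq n s; rewrite ?eqxx.
  pose u j : R := @SemigroupRing k S _ (mono_in _ (gsum_semigroup _ _ (bE j).1)).
  have ch j : exists c : 'I_d -> k, forall n,
      coef (u j - \sum_(i < d) c i *: v i)%R n != 0%R -> gsum S g h.+1 n.
    apply: span_v => n /=; have [-> _|] := eqVneq n (nth 0 b j); last by rewrite eqxx.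
    exact: (bE j).1.
  have [c cP] := choice ch.
  apply/row_fullP; exists (\matrix_(j < size b, i < d) c j i)%R.
  apply/matrixP => j l; rewrite !mxE.
  have E0 : coef (u j - \sum_(i < d) c j i *: v i)%R (nth 0 b l) = 0%R.
    by apply/eqP; apply: contra_notT (bE l).2; exact: cP.
  have -> : ((j == l)%:R = coef (u j) (nth 0 b l) :> k)%R.
    by rewrite /coef /= nth_uniq ?order_layer_uniq // eq_sym.
  have -> : coef (u j) (nth 0 b l) = coef (\sum_(i < d) c j i *: v i)%R (nth 0 b l).
    by apply/eqP; rewrite -subr_eq0; apply/eqP.
  by rewrite coef_comb; apply: eq_bigr => i _; rewrite !mxE.
by move: freeA fullA; rewrite /row_free /row_full => /eqP -> /eqP.
Qed.

End Orders.

Theorem corollary2p4 (k : fieldType) (S : semigroup) (g : seq nat)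
  (k_infinite : infinite_set [set: k])
  (S_gen : numerical_semigroup_on S g)
  (D_le : forall h, 2 <= h -> Dset S (head 0 g) h #<= `I_h.+1) :
  forall h, 1 <= h -> hilbert_function k S g h.-1 <= hilbert_function k S g h.
Proof.
case=> // h _; rewrite !(hilbert_function_size S_gen) /=.
apply: (order_layer_size_le S_gen); apply: (D_size_le_C_size S_gen).
have uD : uniq (Dlist S g h) by rewrite !filter_uniq ?undup_uniq.
case: h uD => [|h] uD.
  (* The bound |D_1| <= 2 holds because D_1 is contained in the layer {0}. *)
  apply: leq_trans (_ : size [:: 0] <= 2) => //; apply: uniq_leq_size => // s.
  by rewrite !mem_filter mem_undup => /andP[_ /andP[]].
apply: leq_trans (geq_card_fset_set (D_le h.+2 isT)).
apply: uniq_leq_size => // s Ds.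
by rewrite (Dset_Dlist S_gen) in_fset_set ?mem_set //; exact: finite_seq.
Qed.
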